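(* Let $\tau\ge1$ be an integer, and let $m,n,m'$ be integers with $1\le m'\le m-1$, $m'+\tau-1\le m$ and $\tau\le n$. Let $\{z_1^1,\dots,z_{m+1}^1;u_1^1,\dots,u_m^1\}$ be a local optimizer of the linearized problem $\mathcal P_1'(y_0;m;\cdot)$ with reference pair $y_0=(z_0',u_0')$ and affine dynamics $z_{i+1}=A_i^1z_i+B_i^1u_i+w_i^1$, and let $\{z_1^2,\dots,z_{n+1}^2;u_1^2,\dots,u_n^2\}$ be a local optimizer of the linearized problem $\mathcal P_1'(y_0';n;\cdot)$ with reference pair $y_0'=(z_{m'+1}^1,u_{m'}^1)$ and affine dynamics $z_{i+1}=A_i^2z_i+B_i^2u_i+w_i^2$. Assume: (a) (Rank) the matrices $B_i^\ell$ have full column rank, and for $\ell=1,2$ every $\tau$-step reachability matrix $$\mathcal C_i^\ell=\left[B_i^\ell,\;A_i^\ell B_{i-1}^\ell,\;\cdots,\;A_i^\ell\cdots A_{i-\tau+2}^\ell B_{i-\tau+1}^\ell\right]$$ has full row rank $n_z$; (b) (MFCQ) the local optimizers satisfy the Mangasarian–Fromovitz constraint qualification; (c) the inputs $u_i^1$ ($m'\le i\le m'+\tau-1$) and $u_i^2$ ($1\le i\le\tau$) are strictly feasible for the input bound, i.e. $u^\top Q_2u<1$; (d) the states $z_i^1$ ($m'+1\le i\le m'+\tau-1$) and $z_i^2$ ($1\le i\le\tau$) are strictly feasible for the collision and state-bound constraints, i.e. $\|z[1:2]-p_j\|>r_j$ for all $j$ and $z^\top Q_1z<1$. Then the concatenated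 sequence $$\{z_1^1,\dots,z_{m'+1}^1,z_2^2,\dots,z_{n+1}^2;\;u_1^1,\dots,u_{m'}^1,u_1^2,\dots,u_n^2\}$$ satisfies the KKT conditions of the linearized problem $\mathcal P_1'(y_0;m'+n;\cdot)$ with affine dynamics $z_{i+1}=A_iz_i+B_iu_i+w_i$, where $$(A_i,B_i,w_i)=\begin{cases}(A_i^1,B_i^1,w_i^1),&i\le m',\\(A_{i-m'}^2,B_{i-m'}^2,w_{i-m'}^2),&i>m'.\end{cases}$$
   Context: Notation: $a[1:2]$ denotes the first two entries of a vector; $\|a\|_Q=\sqrt{a^\top Qa}$. States $z\in\mathbb R^{n_z}$, inputs $u\in\mathbb R^{n_u}$, positive definite matrices $Q_0,Q_1,Q_2$, target $z_f\in\mathbb R^{n_z}$, obstacle centers $p_j\in\mathbb R^2$ and radii $r_j>0$, $1\le j\le n_{obs}$; $G_1(z)=z^\top Q_1z-1$, $G_2(u)=u^\top Q_2u-1$. Linearized problem $\mathcal P_1'(y_0;N;\cdot)$ with reference pair $y_0=(z_0',u_0')$ and affine dynamics $(A_i,B_i,w_i)_{1\le i\le N}$: over sequences $\{z_1,\dots,z_{N+1};u_1,\dots,u_N\}$ minimize $\|z_{N+1}-z_f\|_{Q_0}^2$ subject to $z_1=z_0'$; $z_{i+1}=A_iz_i+B_iu_i+w_i$, $1\le i\le N$; $G_1(z_i)\le0$, $1\le i\le N+1$; $G_2(u_i)\le0$, $1\le i\le N$; $\|z_i[1:2]-p_j\|\ge r_j$, $1\le i\le N+1$, $1\le j\le n_{obs}$.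 (In the paper's planning cycles the matrices arise by linearizing the nonlinear dynamics $z_{i+1}=f(z_i,u_i)$ at the reference pair.) Since $z_1$ is pinned to $z_0'$, it is not regarded as a decision variable. Lagrangian: $$\mathscr L_N=\|z_{N+1}-z_f\|_{Q_0}^2+\sum_{i=1}^N\upsilon_i^\top(z_{i+1}-A_iz_i-B_iu_i-w_i)+\sum_{i=1}^{N+1}\sum_{j=1}^{n_{obs}}\zeta_{ij}\left(r_j^2-\|z_i[1:2]-p_j\|^2\right)+\sum_{i=1}^{N+1}s_iG_1(z_i)+\sum_{i=1}^Nq_iG_2(u_i).$$ A sequence satisfies the KKT conditions if it is feasible and there exist multipliers $(\upsilon,\zeta,s,q)$ with $\partial\mathscr L_N/\partial z_i=0$ for $2\le i\le N+1$, $\partial\mathscr L_N/\partial u_i=0$ for $1\le i\le N$, $\zeta_{ij}(r_j^2-\|z_i[1:2]-p_j\|^2)=0$, $s_iG_1(z_i)=0$, $q_iG_2(u_i)=0$, and $\zeta_{ij},s_i,q_i\ge0$ for all admissible indices. Mangasarian–Fromovitz constraint qualification at a point: the gradients of all equality constraints are linearly independent, and there is a vector orthogonal to the gradients of all equality constraints that is a (strict) descent direction for every active inequality constraint. *)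

(* Defs.v *)
From HB Require Import structures.
From mathcomp Require Export all_boot all_order all_algebra.
From mathcomp Require Export all_classical all_reals all_analysis.
Export Order.TTheory GRing.Theory Num.Theory.
Export numFieldNormedType.Exports.

Set Implicit Arguments.
Unset Strict Implicit.
Unset Printing Implicit Defensive.

Local Open Scope ring_scope.

(* A sequence z_1, z_2, ..., z_N (and likewise u, A, B, w, the multipliers) is
   a function on nat, numbered from 1; only the entries in the stated range are
   ever read. *)

Definition quad (R : realType) (n : nat) (Q : 'M[R]_n) (a : 'cV[R]_n) : R :=
  (a^T *m Q *m a) 0 0.

Definition qnorm (R : realType) (n : nat) (Q : 'M[R]_n) (a : 'cV[R]_n) : R :=
  Num.sqrt (quad Q a).

Definition enorm (R : realType) (n : nat) (a : 'cV[R]_n) : R := qnorm 1%:M a.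

Definition posdefmx (R : realType) (n : nat) (Q : 'M[R]_n) : Prop :=
  Q^T = Q /\ forall a : 'cV[R]_n, a != 0 -> 0 < quad Q a.

Record setting (R : realType) (nz nu nobs : nat) := Setting {
  dim_ge2 : (2 <= nz)%N;
  Q0 : 'M[R]_nz;
  Q1 : 'M[R]_nz;
  Q2 : 'M[R]_nu;
  zf : 'cV[R]_nz;
  center : 'I_nobs -> 'cV[R]_2;
  radius : 'I_nobs -> R }.

Record dynamics (R : realType) (nz nu : nat) := Dynamics {
  dynA : nat -> 'M[R]_nz;
  dynB : nat -> 'M[R]_(nz, nu);
  dynw : nat -> 'cV[R]_nz }.

Section Problem.
Variables (R : realType) (nz nu nobs : nat) (P : setting R nz nu nobs).

Implicit Types (z : nat -> 'cV[R]_nz) (u : nat -> 'cV[R]_nu).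

Definition pos2 (a : 'cV[R]_nz) : 'cV[R]_2 := rowsub (widen_ord (dim_ge2 P)) a.

Definition G1 (a : 'cV[R]_nz) : R := quad (Q1 P) a - 1.
Definition G2 (b : 'cV[R]_nu) : R := quad (Q2 P) b - 1.

Definition obs_dist (a : 'cV[R]_nz) (j : 'I_nobs) : R :=
  enorm (pos2 a - center P j).

(* The obstacle constraint in the form Hobs <= 0 in which it enters the
   Lagrangian; as radii are positive, Hobs j a <= 0 iff obs_dist a j >= r_j. *)
Definition Hobs (j : 'I_nobs) (a : 'cV[R]_nz) : R :=
  radius P j ^+ 2 - obs_dist a j ^+ 2.

Definition objective (N : nat) z : R := qnorm (Q0 P) (z N.+1 - zf P) ^+ 2.

Definition residual (D : dynamics R nz nu) (i : nat) z u : 'cV[R]_nz :=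
  z i.+1 - dynA D i *m z i - dynB D i *m u i - dynw D i.

(* y0 is the reference pair (z0', u0'); given the affine dynamics D, the
   problem depends on it through z0' only. *)
Definition feasible (y0 : 'cV[R]_nz * 'cV[R]_nu) (N : nat)
    (D : dynamics R nz nu) z u : Prop :=
  [/\ z 1%N = y0.1,
      forall i, (1 <= i <= N)%N ->
        z i.+1 = dynA D i *m z i + dynB D i *m u i + dynw D i,
      forall i, (1 <= i <= N.+1)%N -> G1 (z i) <= 0,
      forall i, (1 <= i <= N)%N -> G2 (u i) <= 0
    & forall i j, (1 <= i <= N.+1)%N -> radius P j <= obs_dist (z i) j].

Definition local_optimizer (y0 : 'cV[R]_nz * 'cV[R]_nu) (N : nat)
    (D : dynamics R nz nu) z u : Prop :=
  feasible y0 N D z u /\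
  exists2 e : R, 0 < e &
    forall z' u', feasible y0 N D z' u' ->
      (forall i, (1 <= i <= N.+1)%N -> enorm (z' i - z i) < e) ->
      (forall i, (1 <= i <= N)%N -> enorm (u' i - u i) < e) ->
      objective N z <= objective N z'.

Definition lagrangian (N : nat) (D : dynamics R nz nu)
    (ups : nat -> 'cV[R]_nz) (zeta : nat -> 'I_nobs -> R) (s q : nat -> R)
    z u : R :=
  objective N z
  + \sum_(1 <= i < N.+1) ((ups i)^T *m residual D i z u) 0 0
  + \sum_(1 <= i < N.+2) \sum_j zeta i j * Hobs j (z i)
  + \sum_(1 <= i < N.+2) s i * G1 (z i)
  + \sum_(1 <= i < N.+1) q i * G2 (u i).

Definition partial_z (F : (nat -> 'cV[R]_nz) -> (nat -> 'cV[R]_nu) -> R)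
    z u (i : nat) : 'cV[R]_nz :=
  \col_a 'D_(delta_mx a 0) (fun x : 'cV[R]_nz => F [eta z with i |-> x] u) (z i).

Definition partial_u (F : (nat -> 'cV[R]_nz) -> (nat -> 'cV[R]_nu) -> R)
    z u (i : nat) : 'cV[R]_nu :=
  \col_a 'D_(delta_mx a 0) (fun x : 'cV[R]_nu => F z [eta u with i |-> x]) (u i).

Definition KKT (y0 : 'cV[R]_nz * 'cV[R]_nu) (N : nat)
    (D : dynamics R nz nu) z u : Prop :=
  feasible y0 N D z u /\
  exists (ups : nat -> 'cV[R]_nz) (zeta : nat -> 'I_nobs -> R) (s q : nat -> R),
    [/\ forall i, (2 <= i <= N.+1)%N ->
          partial_z (lagrangian N D ups zeta s q) z u i = 0,
        forall i, (1 <= i <= N)%N ->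
          partial_u (lagrangian N D ups zeta s q) z u i = 0,
        forall i j, (1 <= i <= N.+1)%N ->
          zeta i j * Hobs j (z i) = 0 /\ 0 <= zeta i j,
        forall i, (1 <= i <= N.+1)%N -> s i * G1 (z i) = 0 /\ 0 <= s i
      & forall i, (1 <= i <= N)%N -> q i * G2 (u i) = 0 /\ 0 <= q i].

(* Vectors indexed by the decision variables z_2, ..., z_{N+1} (columns of the
   first block) and u_1, ..., u_N (columns of the second); z_1 is pinned. *)
Definition decision (N : nat) := ('M[R]_(nz, N) * 'M[R]_(nu, N))%type.

Definition gradient (N : nat)
    (F : (nat -> 'cV[R]_nz) -> (nat -> 'cV[R]_nu) -> R) z u : decision N :=
  (\matrix_(a < nz, k < N) partial_z F z u k.+2 a 0,
   \matrix_(a < nu, k < N) partial_u F z u k.+1 a 0).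

Definition dot (N : nat) (x y : decision N) : R :=
  \tr (x.1^T *m y.1) + \tr (x.2^T *m y.2).

(* The scalar equality constraints are the coordinates c of the residuals of
   the steps k+1 = 1, ..., N. *)
Definition eq_gradient (N : nat) (D : dynamics R nz nu) z u
    (kc : 'I_N * 'I_nz) : decision N :=
  gradient N (fun z' u' => residual D kc.1.+1 z' u' kc.2 0) z u.

(* Inequality constraints at i = 1 are included; their gradient in the
   decision variables vanishes, so the condition forces them to be inactive. *)
Definition MFCQ (N : nat) (D : dynamics R nz nu) z u : Prop :=
  free (codom (@eq_gradient N D z u)) /\
  exists d : decision N,
    [/\ forall kc, dot (eq_gradient D z u kc) d = 0,
        forall i j, (1 <= i <= N.+1)%N -> Hobs j (z i) = 0 ->
          dot (gradient N (fun z' _ => Hobs j (z' i)) z u) d < 0,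
        forall i, (1 <= i <= N.+1)%N -> G1 (z i) = 0 ->
          dot (gradient N (fun z' _ => G1 (z' i)) z u) d < 0
      & forall i, (1 <= i <= N)%N -> G2 (u i) = 0 ->
          dot (gradient N (fun _ u' => G2 (u' i)) z u) d < 0].

End Problem.

(* [ B_i, A_i B_{i-1}, ..., A_i ... A_{i-tau+2} B_{i-tau+1} ], for i >= tau. *)
Definition reachability (R : realType) (nz nu : nat) (tau : nat)
    (D : dynamics R nz nu) (i : nat) : 'M[R]_(nz, \sum_(k < tau) nu) :=
  \mxrow_(k < tau)
    ((\big[mulmx/1%:M]_(0 <= l < k) dynA D (i - l)) *m dynB D (i - k)).

Definition rank_condition (R : realType) (nz nu : nat) (tau N : nat)
    (D : dynamics R nz nu) : Prop :=
  (forall i, (1 <= i <= N)%N -> \rank (dynB D i) = nu) /\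
  (forall i, (tau <= i <= N)%N -> \rank (reachability tau D i) = nz).

Definition concat_dynamics (R : realType) (nz nu : nat) (m' : nat)
    (D1 D2 : dynamics R nz nu) : dynamics R nz nu :=
  Dynamics
    (fun i => if (i <= m')%N then dynA D1 i else dynA D2 (i - m'))
    (fun i => if (i <= m')%N then dynB D1 i else dynB D2 (i - m'))
    (fun i => if (i <= m')%N then dynw D1 i else dynw D2 (i - m')).

(* z^1_1, ..., z^1_{m'+1}, z^2_2, z^2_3, ... *)
Definition concat_states (R : realType) (nz : nat) (m' : nat)
    (z1 z2 : nat -> 'cV[R]_nz) : nat -> 'cV[R]_nz :=
  fun i => if (i <= m'.+1)%N then z1 i else z2 (i - m')%N.

Definition concat_inputs (R : realType) (nu : nat) (m' : nat)
    (u1 u2 : nat -> 'cV[R]_nu) : nat -> 'cV[R]_nu :=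
  fun i => if (i <= m')%N then u1 i else u2 (i - m')%N.

(* Main.v *)
From HB Require Import structures.
Require Import Defs.
From mathcomp Require Import ring lra zify.

(* Multipliers for the concatenated problem are those of the second problem,
   delayed by m', and zero before.  This works because the objective sees only
   the final state, so the first m' stages impose no stationarity condition
   except at the junction z_{m'+1} = z^2_1, which was pinned in the second
   problem and becomes free.  There the condition reads A_1^T ups_1 = 0, and
   ups_1 = 0 because on the first tau stages the inequality multipliers vanish:
   B_i^T ups_i = 0 and ups_{i-1} = A_i^T ups_i give ups_tau^T C_tau = 0.

   The multipliers of the second problem come from Farkas' lemma.  Since the
   equality constraints are affine, a direction that annihilates them and
   strictly decreases the active inequality constraints can be followed exactly
   for a short time, so it cannot decrease the objective; no implicit function
   theorem is involved.  All functions being quadratic, derivatives are read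
   off exact second-order expansions. *)

Set Implicit Arguments.
Unset Strict Implicit.
Unset Printing Implicit Defensive.

Local Open Scope classical_set_scope.
Local Open Scope ring_scope.

(** * Farkas' lemma for finitely many linear functionals on an arbitrary vector space *)

Lemma scalar0 (R : pzRingType) (V : lmodType R) (f : V -> R) : scalar f -> f 0 = 0.
Proof. by move=> lf; have := lf (-1) 0 0; rewrite scaler0 addr0 mulN1r addNr. Qed.

Lemma scalarZ (R : pzRingType) (V : lmodType R) (f : V -> R) k x :
  scalar f -> f (k *: x) = k * f x.
Proof. by move=> lf; rewrite -[k *: x]addr0 lf scalar0 // addr0. Qed.

(* Bartl's induction: if the remaining functionals do not imply [c <= 0], a
   witness [xb] splits the space, and one projects along it onto the kernel of
   [a i0]. *)
Lemma farkas_seq (R : realFieldType) (V : lmodType R) (I : eqType) (r : seq I)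
    (a : I -> V -> R) (c : V -> R) :
  uniq r -> (forall i, scalar (a i)) -> scalar c ->
  (forall x, (forall i, i \in r -> a i x <= 0) -> c x <= 0) ->
  exists2 l : I -> R, forall i, 0 <= l i &
    forall x, c x = \sum_(i <- r) l i * a i x.
Proof.
elim: r a c => [|i0 r IHr] a c /= ur la lc hc.
  exists (fun=> 0) => // x; rewrite big_nil; apply/le_anti/andP; split.
    exact: hc.
  (* Without constraints the hypothesis also holds at the opposite vector, so [c] vanishes. *)
  have := hc (-1 *: x + 0) (fun i => ltac:(by [])).
  rewrite lc.
  rewrite scalar0 //; lra.
case/andP: ur => i0r ur.
have [[xb xb1 xb2]|nex] := pselect (exists2 x, (forall i, i \in r -> a i x <= 0) & 0 < c x);
  last first.
  have [x hx|l l0 lE] := IHr a c ur la lc.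
    by rewrite leNgt; apply/negP => cx; apply: nex; exists x.
  exists (fun i => if i == i0 then 0 else l i).
    by move=> i; case: ifP.
  move=> x; rewrite big_cons eqxx mul0r add0r lE; apply: eq_big_seq => i ir.
  by case: eqP ir i0r => // -> ->.
have a0 : 0 < a i0 xb.
  rewrite ltNge; apply/negP => ai0; move: xb2; rewrite ltNge => /negP; apply.
  by apply: hc => i; rewrite in_cons => /predU1P[->|/xb1].
pose x0 := (a i0 xb)^-1 *: xb.
have aix0 : a i0 x0 = 1 by rewrite scalarZ // mulVf ?gt_eqF.
have ax0 i : i \in r -> a i x0 <= 0.
  by move=> ir; rewrite scalarZ // pmulr_rle0 ?invr_gt0 // xb1.
have cx0 : 0 <= c x0 by rewrite scalarZ // mulr_ge0 ?invr_ge0 // ltW.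
pose pr x := - a i0 x *: x0 + x.
have lpr (f : V -> R) : scalar f -> scalar (f \o pr).
  move=> lf k x y; rewrite /= /pr !lf la; lra.
have [x hx|l l0 lE] :=
    IHr (fun i => a i \o pr) (c \o pr) ur (fun i => lpr _ (la i)) (lpr _ lc).
  apply: hc => i; rewrite in_cons => /predU1P[->|ir]; last exact: hx.
  by rewrite /pr la aix0 mulr1 addNr.
(* Expanding [c \o pr] leaves exactly this coefficient on [a i0]; it is nonnegative because
   [c x0 >= 0] while each [a i x0 <= 0]. *)
pose k := c x0 - \sum_(i <- r) l i * a i x0.
exists (fun i => if i == i0 then k else l i).
  move=> i; case: ifP => // _; rewrite subr_ge0; apply: le_trans cx0.
  rewrite big_seq sumr_le0 // => j jr; rewrite mulr_ge0_le0 //; exact: ax0.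
move=> x; rewrite big_cons eqxx.
have -> : \sum_(i <- r) (if i == i0 then k else l i) * a i x =
    \sum_(i <- r) l i * a i x.
  by apply: eq_big_seq => i ir; case: eqP ir i0r => // -> ->.
have := lE x; rewrite /= /pr lc => cE.
have {cE}-> : c x = a i0 x * c x0 + \sum_(i <- r) l i * a i (- a i0 x *: x0 + x) by lra.
have -> : \sum_(i <- r) l i * a i (- a i0 x *: x0 + x) =
    \sum_(i <- r) l i * a i x - a i0 x * \sum_(i <- r) l i * a i x0.
  by rewrite mulr_sumr -sumrB; apply: eq_bigr => i _; rewrite la; ring.
by rewrite /k; ring.
Qed.

(** Each equality enters as two opposite inequalities; the difference of their two multipliers is a
    multiplier of free sign. *)
Lemma farkas (R : realFieldType) (V : lmodType R) (E I : finType)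
    (e : E -> V -> R) (a : I -> V -> R) (c : V -> R) :
  (forall j, scalar (e j)) -> (forall i, scalar (a i)) -> scalar c ->
  (forall x, (forall j, e j x = 0) -> (forall i, a i x <= 0) -> c x <= 0) ->
  exists (m : E -> R) (l : I -> R), (forall i, 0 <= l i) /\
    forall x, c x = \sum_j m j * e j x + \sum_i l i * a i x.
Proof.
move=> le la lc hc.
pose b (k : E + E + I) : V -> R := match k with
  | inl (inl j) => e j | inl (inr j) => fun x => - e j x | inr i => a i end.
have lb k : scalar (b k).
  by case: k => [[j|j]|i] //= k x y; rewrite le; lra.
have [x hx|l l0 lE] := @farkas_seq R V _ (index_enum _) b c (index_enum_uniq _) lb lc.
  apply: hc => [j|i]; last exact: (hx (inr i) (mem_index_enum _)).
  have := hx (inl (inl j)) (mem_index_enum _).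
  have := hx (inl (inr j)) (mem_index_enum _) => /=; lra.
exists (fun j => l (inl (inl j)) - l (inl (inr j))), (l \o inr).
split=> [i|x]; first exact: l0.
rewrite lE !big_sumType /= -big_split /=; congr (_ + _).
by apply: eq_bigr => j _; lra.
Qed.

(** * Quadratic functions along a line: derivative and sign near zero *)

(** For [h != 0] the difference quotient is exactly [l + h * c], so the derivative is computed
    without first proving [f] differentiable. *)
Lemma derive_quadratic (R : realType) (V : normedModType R) (f : V -> R) (x v : V)
    (l c : R) :
  (forall h, f (x + h *: v) = f x + h * l + h ^+ 2 * c) -> 'D_v f x = l.
Proof.
move=> fE; rewrite /derive.
apply/norm_cvg_lim.
have lcE : (fun h : R => l + h * c) h @[h --> 0^'] --> l.
  rewrite -[X in _ --> X]addr0 -[X in _ --> _ + X](mul0r c).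
  apply: cvgD; first exact: cvg_cst.
  by apply: cvgM; [exact: nbhs_dnbhs | exact: cvg_cst].
apply: cvg_trans lcE; apply: near_eq_cvg.
near=> h.
have h0 : h != 0 by near: h; exact: nbhs_dnbhs_neq.
rewrite /= [h *: v + x]addrC fE.
have -> : f x + h * l + h ^+ 2 * c - f x = h * (l + h * c) by ring.
by rewrite /GRing.scale /= mulKf.
Unshelve. all: by end_near.
Qed.

(** For small positive [t] the first nonzero coefficient decides the sign. The two cases are an
    active constraint with a descent direction and an inactive constraint in any direction. *)
Lemma near0_quadratic_lt0 (R : realType) (g l c : R) :
  g <= 0 -> (g = 0 -> l < 0) -> \forall t \near 0^'+, g + t * l + t ^+ 2 * c < 0.
Proof.
rewrite le_eqVlt => /predU1P[-> /(_ erefl) l0|g0 _].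
  (* After factoring out [t], this threshold makes [t * c < - l]; the added 1 keeps the denominator
     positive. *)
  have e0 : 0 < - l / (`|c| + 1) by rewrite divr_gt0 ?oppr_gt0 ?ltr_wpDl.
  near=> t.
  have t0 : 0 < t by near: t; exact: nbhs_right_gt.
  have : t * (`|c| + 1) < - l.
    by rewrite -ltr_pdivlMr ?ltr_wpDl //; near: t; exact: nbhs_right_lt.
  have := ler_norm c => cc tc.
  have : t * c <= t * `|c| by rewrite ler_wpM2l // ltW.
  move=> tcc; rewrite add0r expr2 -mulrA -mulrDr pmulr_rlt0 //; lra.
(* With [t < 1] the square is bounded by [t], so both perturbations together stay below [- g]. *)
have e0 : 0 < - g / (`|l| + `|c| + 1).
  by rewrite divr_gt0 ?oppr_gt0 ?ltr_wpDl ?addr_ge0.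
near=> t.
have t0 : 0 < t by near: t; exact: nbhs_right_gt.
have t1 : t < 1 by near: t; exact: nbhs_right_lt.
have : t * (`|l| + `|c| + 1) < - g.
  rewrite -ltr_pdivlMr ?ltr_wpDl ?addr_ge0 //; near: t; exact: nbhs_right_lt.
have tl : t * l <= t * `|l| by rewrite ler_wpM2l ?ler_norm // ltW.
have tc : t ^+ 2 * c <= t * `|c|.
  rewrite expr2 -mulrA ler_wpM2l ?(ltW t0) // (le_trans (ler_norm _)) //.
  by rewrite normrM ler_piMl // ger0_norm ltW.
lra.
Unshelve. all: by end_near.
Qed.

(** * Exact second-order expansions of functions of a trajectory *)

Section QuadraticExpansion.
Variables (R : realType) (nz nu : nat).

Definition traj := ((nat -> 'cV[R]_nz) * (nat -> 'cV[R]_nu))%type.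

Implicit Types (F : (nat -> 'cV[R]_nz) -> (nat -> 'cV[R]_nu) -> R).
Implicit Types (z : nat -> 'cV[R]_nz) (u : nat -> 'cV[R]_nu) (d : traj).

(** [DF] is the differential at [(z, u)]. Directions are whole trajectories, so moving the pinned
    state is allowed as well. The second-order coefficient [c] may be any function of the direction,
    since only its existence matters. *)
Definition expansion F z u (DF : traj -> R) : Prop :=
  scalar DF /\ exists c : traj -> R, forall h d,
    F (z + h *: d.1) (u + h *: d.2) = F z u + h * DF d + h ^+ 2 * c d.

Lemma expansion_affine F z u DF : scalar DF ->
  (forall h d, F (z + h *: d.1) (u + h *: d.2) = F z u + h * DF d) ->
  expansion F z u DF.
Proof. by move=> lDF FE; split=> //; exists (fun=> 0) => h d; rewrite FE mulr0 addr0. Qed.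

Lemma expansionD F G z u DF DG : expansion F z u DF -> expansion G z u DG ->
  expansion (fun z u => F z u + G z u) z u (fun d => DF d + DG d).
Proof.
move=> [lF [c cE]] [lG [b bE]]; split=> [k x y|]; first by rewrite lF lG; ring.
by exists (fun d => c d + b d) => h d; rewrite cE bE; ring.
Qed.

Lemma expansionZ k F z u DF : expansion F z u DF ->
  expansion (fun z u => k * F z u) z u (fun d => k * DF d).
Proof.
move=> [lF [c cE]]; split=> [a x y|]; first by rewrite lF; ring.
by exists (fun d => k * c d) => h d; rewrite cE; ring.
Qed.

Lemma expansionB_cst k F z u DF : expansion F z u DF ->
  expansion (fun z u => F z u - k) z u DF.
Proof.
move=> [lF [c cE]]; split=> //.
by exists c => h d; rewrite cE; ring.
Qed.

Lemma expansion_cstB k F z u DF : expansion F z u DF ->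
  expansion (fun z u => k - F z u) z u (fun d => - DF d).
Proof.
move=> [lF [c cE]]; split=> [a x y|]; first by rewrite lF; ring.
by exists (fun d => - c d) => h d; rewrite cE; ring.
Qed.

Lemma expansion_sum (I : Type) (r : seq I)
    (F : I -> (nat -> 'cV[R]_nz) -> (nat -> 'cV[R]_nu) -> R) z u DF :
  (forall i, expansion (F i) z u (DF i)) ->
  expansion (fun z u => \sum_(i <- r) F i z u) z u
    (fun d => \sum_(i <- r) DF i d).
Proof.
move=> eF; elim: r => [|i r [lDF [c cE]]].
  split=> [k x y|]; first by rewrite !big_nil; ring.
  by exists (fun=> 0) => h d; rewrite !big_nil; ring.
have [lDi [b bE]] := eF i; split=> [k x y|].
  by rewrite !big_cons lDF lDi; ring.
by exists (fun d => b d + c d) => h d; rewrite !big_cons cE bE; ring.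
Qed.

Lemma expansion_ext F G z u DF : (forall z u, F z u = G z u) ->
  expansion F z u DF -> expansion G z u DF.
Proof.
move=> FG [lDF [c cE]]; split=> //.
by exists c => h d; rewrite -!FG.
Qed.

(** Differential of [quad Q] at [a]; both terms are kept so that [Q] need not be symmetric. *)
Definition dquad k (Q : 'M[R]_k) (a b : 'cV[R]_k) : R :=
  (a^T *m Q *m b) 0 0 + (b^T *m Q *m a) 0 0.

Lemma trmxZD k (a b : 'cV[R]_k) (h : R) : (h *: a + b)^T = h *: a^T + b^T.
Proof. by apply/matrixP => i j; rewrite !mxE. Qed.

Lemma quad_expand k (Q : 'M[R]_k) (a b : 'cV[R]_k) h :
  quad Q (a + h *: b) = quad Q a + h * dquad Q a b + h ^+ 2 * quad Q b.
Proof.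
rewrite /quad /dquad [a + _]addrC trmxZD !mulmxDl !mulmxDr.
rewrite -!scalemxAl -!scalemxAr !mxE; ring.
Qed.

Lemma dquad_scalar k (Q : 'M[R]_k) (a : 'cV[R]_k) : scalar (dquad Q a).
Proof.
move=> h x y; rewrite /dquad trmxZD !mulmxDl !mulmxDr.
by rewrite -!scalemxAl -!scalemxAr !mxE; ring.
Qed.

Lemma dquad0 k (Q : 'M[R]_k) (a : 'cV[R]_k) : dquad Q a 0 = 0.
Proof. by rewrite /dquad trmx0 !mul0mx mulmx0 !mxE addr0. Qed.

Lemma expansion_quad k (Q : 'M[R]_k)
    (a : (nat -> 'cV[R]_nz) -> (nat -> 'cV[R]_nu) -> 'cV[R]_k)
    (L : traj -> 'cV[R]_k) z u : linear L ->
  (forall h d, a (z + h *: d.1) (u + h *: d.2) = a z u + h *: L d) ->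
  expansion (fun z u => quad Q (a z u)) z u (fun d => dquad Q (a z u) (L d)).
Proof.
move=> lL aE; split=> [k0 x y|]; first by rewrite lL dquad_scalar.
by exists (fun d => quad Q (L d)) => h d; rewrite aE quad_expand.
Qed.

Definition single_z (i : nat) (v : 'cV[R]_nz) : traj :=
  ([eta fun=> 0 with i |-> v] : nat -> 'cV[R]_nz, fun=> 0).

Definition single_u (i : nat) (v : 'cV[R]_nu) : traj :=
  (fun=> 0, [eta fun=> 0 with i |-> v] : nat -> 'cV[R]_nu).

Lemma expansion_partial_z F z u DF i : expansion F z u DF ->
  partial_z F z u i = \col_a DF (single_z i (delta_mx a 0)).
Proof.
move=> [lDF [c cE]]; apply/matrixP => a b; rewrite !mxE.
apply: (@derive_quadratic _ _ _ _ _ _ (c (single_z i (delta_mx a 0)))) => h /=.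
(* The partial derivative is based at [z] with entry [i] overwritten by its own value, which is [z]
   itself. *)
have -> : [eta z with i |-> z i] = z :> (nat -> 'cV[R]_nz).
  by apply/funext => k /=; case: eqP => // ->.
rewrite -cE; congr F; apply/funext => k; rewrite !fctE /=.
  by case: eqP => [->|_] //; rewrite scaler0 addr0.
by rewrite scaler0 addr0.
Qed.

Lemma expansion_partial_u F z u DF i : expansion F z u DF ->
  partial_u F z u i = \col_a DF (single_u i (delta_mx a 0)).
Proof.
move=> [lDF [c cE]]; apply/matrixP => a b; rewrite !mxE.
apply: (@derive_quadratic _ _ _ _ _ _ (c (single_u i (delta_mx a 0)))) => h /=.
have -> : [eta u with i |-> u i] = u :> (nat -> 'cV[R]_nu).
  by apply/funext => k /=; case: eqP => // ->.
rewrite -cE; congr F; apply/funext => k; rewrite !fctE /=.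
  by rewrite scaler0 addr0.
by case: eqP => [->|_] //; rewrite scaler0 addr0.
Qed.

(** Column [k] of the state block is state [k + 2] and column [k] of the input block is input
    [k + 1]; all other entries are zero. Writing it as a combination of basis directions lets a
    linear functional be evaluated term by term. *)
Definition traj_of_decision N (d : decision R nz nu N) : traj :=
  (\sum_(k < N) \sum_a d.1 a k *: single_z k.+2 (delta_mx a 0))
  + \sum_(k < N) \sum_a d.2 a k *: single_u k.+1 (delta_mx a 0).

Lemma scalar_sum (DF : traj -> R) (I : finType) (E : I -> traj) : scalar DF ->
  DF (\sum_i E i) = \sum_i DF (E i).
Proof.
move=> lDF; apply: (big_morph DF); last exact: scalar0.
by move=> x y; rewrite -[x in LHS]scale1r lDF mul1r.
Qed.

Lemma scalar_traj_of_decision N (DF : traj -> R) (d : decision R nz nu N) :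
  scalar DF -> DF (traj_of_decision d) =
  (\sum_(k < N) \sum_a d.1 a k * DF (single_z k.+2 (delta_mx a 0)))
  + \sum_(k < N) \sum_a d.2 a k * DF (single_u k.+1 (delta_mx a 0)).
Proof.
move=> lDF; rewrite /traj_of_decision -[X in X + _]scale1r lDF mul1r.
congr (_ + _); rewrite scalar_sum //; apply: eq_bigr => k _;
  rewrite scalar_sum //; apply: eq_bigr => a _; exact: scalarZ.
Qed.

(** Turns the gradient conditions of the constraint qualification into statements on
    differentials. *)
Lemma dot_gradient N F z u DF (d : decision R nz nu N) : expansion F z u DF ->
  dot (gradient N F z u) d = DF (traj_of_decision d).
Proof.
move=> eF; rewrite scalar_traj_of_decision; last by case: eF.
rewrite /dot /mxtrace /=; congr (_ + _); apply: eq_bigr => k _;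
  rewrite mxE; apply: eq_bigr => a _; rewrite 2!mxE.
  by rewrite (expansion_partial_z _ eF) mxE mulrC.
by rewrite (expansion_partial_u _ eF) mxE mulrC.
Qed.

End QuadraticExpansion.

(** * Differentials of the objective, the constraints and the Lagrangian *)

Section ProblemExpansion.
Variables (R : realType) (nz nu nobs : nat) (P : setting R nz nu nobs).
Implicit Types (z : nat -> 'cV[R]_nz) (u : nat -> 'cV[R]_nu) (d : traj R nz nu).

Lemma pos2ZD h (a b : 'cV[R]_nz) : pos2 P (h *: a + b) = h *: pos2 P a + pos2 P b.
Proof. by apply/matrixP => i j; rewrite !mxE. Qed.

Lemma quad1_ge0 k (a : 'cV[R]_k) : 0 <= quad 1%:M a.
Proof.
rewrite /quad mulmx1 mxE sumr_ge0 // => i _.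
by rewrite mxE -expr2 sqr_ge0.
Qed.

Lemma enorm_sqr k (a : 'cV[R]_k) : enorm a ^+ 2 = quad 1%:M a.
Proof. by rewrite sqr_sqrtr ?quad1_ge0. Qed.

Lemma qnorm_sqr k (Q : 'M[R]_k) (a : 'cV[R]_k) :
  posdefmx Q -> qnorm Q a ^+ 2 = quad Q a.
Proof.
move=> [_ Q0]; rewrite sqr_sqrtr //.
have [->|/Q0/ltW//] := eqVneq a 0.
by rewrite /quad mulmx0 mxE.
Qed.

Lemma enorm_lt k (a : 'cV[R]_k) e : 0 < e -> (enorm a < e) = (quad 1%:M a - e ^+ 2 < 0).
Proof.
by move=> e0; rewrite subr_lt0 -enorm_sqr ltr_pXn2r // nnegrE ?sqrtr_ge0 ?ltW.
Qed.

Lemma obs_le_Hobs j a : 0 < radius P j ->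
  (radius P j <= obs_dist P a j) = (Hobs P j a <= 0).
Proof.
by move=> r0; rewrite /Hobs subr_le0 ler_pXn2r // nnegrE ?sqrtr_ge0 ?ltW.
Qed.

Lemma obs_lt_Hobs j a : 0 < radius P j ->
  (radius P j < obs_dist P a j) = (Hobs P j a < 0).
Proof.
by move=> r0; rewrite /Hobs subr_lt0 ltr_pXn2r // nnegrE ?sqrtr_ge0 ?ltW.
Qed.

Definition dG1 z i d := dquad (Q1 P) (z i) (d.1 i).
Definition dG2 u i d := dquad (Q2 P) (u i) (d.2 i).
Definition dHobs z i j d := - dquad 1%:M (pos2 P (z i) - center P j) (pos2 P (d.1 i)).
Definition dobjective N z d := dquad (Q0 P) (z N.+1 - zf P) (d.1 N.+1).
Definition dresidual (D : dynamics R nz nu) i d : 'cV[R]_nz :=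
  d.1 i.+1 - dynA D i *m d.1 i - dynB D i *m d.2 i.

Definition dlagrangian N (D : dynamics R nz nu)
    (ups : nat -> 'cV[R]_nz) (zeta : nat -> 'I_nobs -> R) (s q : nat -> R) z u d : R :=
  dobjective N z d
  + \sum_(1 <= i < N.+1) ((ups i)^T *m dresidual D i d) 0 0
  + \sum_(1 <= i < N.+2) \sum_j zeta i j * dHobs z i j d
  + \sum_(1 <= i < N.+2) s i * dG1 z i d
  + \sum_(1 <= i < N.+1) q i * dG2 u i d.

Lemma expansion_G1 i z u : expansion (fun z _ => G1 P (z i)) z u (dG1 z i).
Proof.
apply: expansionB_cst.
by apply: (@expansion_quad _ _ _ _ _ (fun z _ => z i) (fun d => d.1 i)).
Qed.

Lemma expansion_G2 i z u : expansion (fun _ u => G2 P (u i)) z u (dG2 u i).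
Proof.
apply: expansionB_cst.
by apply: (@expansion_quad _ _ _ _ _ (fun _ u => u i) (fun d => d.2 i)).
Qed.

Lemma expansion_Hobs i j z u : expansion (fun z _ => Hobs P j (z i)) z u (dHobs z i j).
Proof.
apply: expansion_cstB.
apply: (@expansion_ext _ _ _ (fun z _ => quad 1%:M (pos2 P (z i) - center P j))).
  by move=> z' u'; rewrite -enorm_sqr.
apply: (@expansion_quad _ _ _ _ _ (fun z _ => pos2 P (z i) - center P j)
  (fun d => pos2 P (d.1 i))) => [k x y|h d]; first exact: pos2ZD.
by rewrite fctE [z i + _]addrC pos2ZD -addrA addrC.
Qed.

(** Positive definiteness makes the squared root in [objective] equal to the quadratic form. *)
Lemma expansion_objective N z u : posdefmx (Q0 P) ->
  expansion (fun z _ => objective P N z) z u (dobjective N z).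
Proof.
move=> hQ0.
apply: (@expansion_ext _ _ _ (fun z _ => quad (Q0 P) (z N.+1 - zf P))).
  by move=> z' u'; rewrite /objective qnorm_sqr.
apply: (@expansion_quad _ _ _ _ _ (fun z _ => z N.+1 - zf P)
  (fun d => d.1 N.+1)) => [k x y|h d]; first by [].
by rewrite fctE addrAC.
Qed.

Lemma dresidual_linear D i : linear (dresidual D i).
Proof.
move=> k x y; rewrite /dresidual /= !mulmxDr -!scalemxAr !scalerDr !scalerN.
apply/matrixP => a b; rewrite !mxE; ring.
Qed.

Lemma residual_expand D i z u h d :
  residual D i (z + h *: d.1) (u + h *: d.2) = residual D i z u + h *: dresidual D i d.
Proof.
rewrite /residual /dresidual !fctE !mulmxDr -!scalemxAr.
apply/matrixP => a b; rewrite !mxE; ring.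
Qed.

Lemma expansion_residual D i c z u :
  expansion (fun z u => residual D i z u c 0) z u (fun d => dresidual D i d c 0).
Proof.
apply: expansion_affine => [k x y|h d]; first by rewrite dresidual_linear !mxE.
by rewrite residual_expand !mxE.
Qed.

Lemma expansion_residual_ups D i (v : 'cV[R]_nz) z u :
  expansion (fun z u => (v^T *m residual D i z u) 0 0) z u
    (fun d => (v^T *m dresidual D i d) 0 0).
Proof.
apply: expansion_affine => [k x y|h d].
  by rewrite dresidual_linear mulmxDr -scalemxAr !mxE.
by rewrite residual_expand mulmxDr -scalemxAr !mxE.
Qed.

Lemma expansion_lagrangian N D ups zeta s q z u : posdefmx (Q0 P) ->
  expansion (lagrangian P N D ups zeta s q) z u (dlagrangian N D ups zeta s q z u).
Proof.
move=> hQ0; rewrite /lagrangian /dlagrangian.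
apply: expansionD; first apply: expansionD; first apply: expansionD;
  first apply: expansionD; first exact: expansion_objective;
  apply: expansion_sum => i.
- exact: expansion_residual_ups.
- by apply: expansion_sum => j; apply: expansionZ; exact: expansion_Hobs.
- by apply: expansionZ; exact: expansion_G1.
- by apply: expansionZ; exact: expansion_G2.
Qed.

End ProblemExpansion.

(* Numbered from 1, like the sequences of the problem; the value at 0 is junk. *)
Definition extend_ord (T : Type) (n : nat) (x0 : T) (f : 'I_n -> T) (i : nat) : T :=
  oapp f x0 (insub i.-1).

Lemma extend_ordE (T : Type) (n : nat) (x0 : T) (f : 'I_n -> T) (k : 'I_n) :
  extend_ord x0 f k.+1 = f k.
Proof. by rewrite /extend_ord /= valK. Qed.

(** * Multipliers of a local optimizer under the constraint qualification *)

Section KarushKuhnTucker.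
Variables (R : realType) (nz nu nobs : nat) (P : setting R nz nu nobs).
Hypotheses (hQ0 : posdefmx (Q0 P)) (hr : forall j, 0 < radius P j).
Variables (y0 : 'cV[R]_nz * 'cV[R]_nu) (N : nat) (D : dynamics R nz nu).
Variables (z : nat -> 'cV[R]_nz) (u : nat -> 'cV[R]_nu).
Hypothesis hopt : local_optimizer P y0 N D z u.
Implicit Types (d : traj R nz nu).

Lemma residual_eq0P i (z' : nat -> 'cV[R]_nz) (u' : nat -> 'cV[R]_nu) :
  residual D i z' u' = 0 <->
  z' i.+1 = dynA D i *m z' i + dynB D i *m u' i + dynw D i.
Proof.
rewrite /residual -!addrA -!opprD addrA.
by split=> [/subr0_eq | ->]; rewrite ?subrr.
Qed.

Lemma near_range (T : Type) (F : set_system T) (n : nat) (A : nat -> T -> Prop) :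
  Filter F -> (forall i, (1 <= i <= n)%N -> \near F, A i F) ->
  \near F, forall i, (1 <= i <= n)%N -> A i F.
Proof.
move=> FF FA.
have : \near F, forall k : 'I_n, A k.+1 F.
  by apply: filter_forall => k; apply: FA; rewrite ltn_ord.
apply: filterS => x Ax [|i] //= ilt; exact: (Ax (Ordinal ilt)).
Qed.

Lemma expansion_near_lt0 F DF d : expansion F z u DF ->
  F z u <= 0 -> (F z u = 0 -> DF d < 0) ->
  \forall t \near 0^'+, F (z + t *: d.1) (u + t *: d.2) < 0.
Proof.
move=> [_ [c cE]] F0 DF0.
apply: filterS (near0_quadratic_lt0 (c d) F0 DF0) => t; by rewrite cE.
Qed.

(** If the objective had negative slope, the segment [z + t *: d.1], [u + t *: d.2] would, for small
    [t > 0], be feasible, close to the optimizer and strictly better. *)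
Lemma objective_ge0_strict d : d.1 1%N = 0 ->
  (forall i, (1 <= i <= N)%N -> dresidual D i d = 0) ->
  (forall i j, (1 <= i <= N.+1)%N -> Hobs P j (z i) = 0 -> dHobs P z i j d < 0) ->
  (forall i, (1 <= i <= N.+1)%N -> G1 P (z i) = 0 -> dG1 P z i d < 0) ->
  (forall i, (1 <= i <= N)%N -> G2 P (u i) = 0 -> dG2 P u i d < 0) ->
  0 <= dobjective P N z d.
Proof.
move=> d1 dres dH dg1 dg2; rewrite leNgt; apply/negP => dobj.
have [[f1 f2 f3 f4 f5] [e e0 he]] := hopt.
pose zt (t : R) := z + t *: d.1; pose ut (t : R) := u + t *: d.2.
have nG1 : \forall t \near 0^'+, forall i, (1 <= i <= N.+1)%N -> G1 P (zt t i) < 0.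
  apply: near_range => i iN.
  exact: (expansion_near_lt0 (expansion_G1 P i z u) (f3 i iN) (dg1 i iN)).
have nG2 : \forall t \near 0^'+, forall i, (1 <= i <= N)%N -> G2 P (ut t i) < 0.
  apply: near_range => i iN.
  exact: (expansion_near_lt0 (expansion_G2 P i z u) (f4 i iN) (dg2 i iN)).
have nH : \forall t \near 0^'+, forall i, (1 <= i <= N.+1)%N ->
    forall j, Hobs P j (zt t i) < 0.
  apply: near_range => i iN; apply: filter_forall => j.
  apply: (expansion_near_lt0 (expansion_Hobs P i j z u) _ (dH i j iN)).
  by rewrite -obs_le_Hobs // f5.
(* The sign lemma is applied to the quadratic [- e ^+ 2 + t ^+ 2 * quad 1%:M b], negative at
   [t = 0]. *)
have small k (b : 'cV[R]_k) : \forall t \near 0^'+, enorm (t *: b) < e.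
  have en : - e ^+ 2 < 0 by rewrite oppr_lt0 exprn_gt0.
  have ne : - e ^+ 2 = 0 -> (0 : R) < 0 by move=> eq0; move: en; rewrite eq0 ltxx.
  apply: filterS (near0_quadratic_lt0 (quad 1%:M b) (ltW en) ne) => t.
  rewrite enorm_lt // -[t *: b]add0r quad_expand.
  have -> : quad 1%:M (0 : 'cV[R]_k) = 0 by rewrite /quad mulmx0 mxE.
  have -> : dquad 1%:M 0 b = 0.
    by rewrite /dquad trmx0 !mul0mx mulmx0 mxE addr0.
  by rewrite mulr0 !addr0 add0r addrC.
have nz' : \forall t \near 0^'+, forall i, (1 <= i <= N.+1)%N -> enorm (zt t i - z i) < e.
  apply: near_range => i iN; apply: filterS (small _ (d.1 i)) => t.
  by rewrite /zt fctE addrAC subrr add0r.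
have nu' : \forall t \near 0^'+, forall i, (1 <= i <= N)%N -> enorm (ut t i - u i) < e.
  apply: near_range => i iN; apply: filterS (small _ (d.2 i)) => t.
  by rewrite /ut fctE addrAC subrr add0r.
have [lobj [c cE]] := expansion_objective N z u hQ0.
have ndec := near0_quadratic_lt0 (c d) (lexx 0) (fun=> dobj).
near (0 : R)^'+ => t.
have t1 : forall i, (1 <= i <= N.+1)%N -> G1 P (zt t i) < 0 by near: t.
have t2 : forall i, (1 <= i <= N)%N -> G2 P (ut t i) < 0 by near: t.
have t3 : forall i, (1 <= i <= N.+1)%N -> forall j, Hobs P j (zt t i) < 0 by near: t.
have t4 : forall i, (1 <= i <= N.+1)%N -> enorm (zt t i - z i) < e by near: t.
have t5 : forall i, (1 <= i <= N)%N -> enorm (ut t i - u i) < e by near: t.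
have t6 : 0 + t * dobjective P N z d + t ^+ 2 * c d < 0 by near: t.
suff : objective P N z <= objective P N (zt t).
  by rewrite cE leNgt -addrA -subr_gt0 opprD addrA subrr add0r oppr_gt0 -[_ + _]add0r addrA t6.
apply: (he (zt t) (ut t)) => //; split.
- by rewrite -[LHS]/(z 1%N + t *: d.1 1%N) d1 scaler0 addr0 f1.
- move=> i iN; apply/residual_eq0P.
  by rewrite residual_expand dres // scaler0 addr0; apply/residual_eq0P/f2.
- by move=> i iN; apply/ltW/t1.
- by move=> i iN; apply/ltW/t2.
- by move=> i j iN; rewrite obs_le_Hobs //; apply/ltW/t3.
Unshelve. all: by end_near.
Qed.

Hypothesis hMFCQ : MFCQ P N D z u.

(* Adding a small multiple of the MFCQ direction makes the inequalities strict. *)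
Lemma objective_ge0 d : d.1 1%N = 0 ->
  (forall i, (1 <= i <= N)%N -> dresidual D i d = 0) ->
  (forall i j, (1 <= i <= N.+1)%N -> Hobs P j (z i) = 0 -> dHobs P z i j d <= 0) ->
  (forall i, (1 <= i <= N.+1)%N -> G1 P (z i) = 0 -> dG1 P z i d <= 0) ->
  (forall i, (1 <= i <= N)%N -> G2 P (u i) = 0 -> dG2 P u i d <= 0) ->
  0 <= dobjective P N z d.
Proof.
have [_ [x [xE xH xG1 xG2]]] := hMFCQ.
pose x0 := traj_of_decision x.
(* The decision variables begin at state 2, so this trajectory leaves the initial state fixed. *)
have x01 : x0.1 1%N = 0.
  apply/matrixP => a b; rewrite ord1 [RHS]mxE.
  pose L d := d.1 1%N a 0.
  have lL : scalar L by move=> k v w; rewrite /L !mxE.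
  rewrite -[LHS]/(L x0) scalar_traj_of_decision // !big1 ?addr0 // => k _;
    by rewrite big1 // => c _; rewrite /L /= mxE mulr0.
have x0res i : (1 <= i <= N)%N -> dresidual D i x0 = 0.
  case: i => // i /= iN; apply/matrixP => c b; rewrite ord1 [RHS]mxE.
  by rewrite -(xE (Ordinal iN, c)) (dot_gradient _ (expansion_residual _ _ _ _ _)).
move=> d1 dres dH dg1 dg2.
have ge0 h : 0 < h -> 0 <= dobjective P N z d + h * dobjective P N z x0.
  move=> h0.
  have [lobj _] := expansion_objective N z u hQ0.
  rewrite addrC -lobj; apply: objective_ge0_strict.
  - by rewrite -[LHS]/(h *: x0.1 1%N + d.1 1%N) x01 d1 scaler0 addr0.
  - by move=> i iN; rewrite dresidual_linear x0res // dres // scaler0 addr0.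
  - move=> i j iN Hij; have [lF _] := expansion_Hobs P i j z u.
    rewrite lF ltr_wnDr ?dH // pmulr_rlt0 //.
    by rewrite -(dot_gradient _ (expansion_Hobs P i j z u)) xH.
  - move=> i iN Hij; have [lF _] := expansion_G1 P i z u.
    rewrite lF ltr_wnDr ?dg1 // pmulr_rlt0 //.
    by rewrite -(dot_gradient _ (expansion_G1 P i z u)) xG1.
  - move=> i iN Hij; have [lF _] := expansion_G2 P i z u.
    rewrite lF ltr_wnDr ?dg2 // pmulr_rlt0 //.
    by rewrite -(dot_gradient _ (expansion_G2 P i z u)) xG2.
rewrite leNgt; apply/negP => dneg.
(* The zero quadratic term brings the affine function of [t] into the form of the sign lemma. *)
have : \forall t \near 0^'+, dobjective P N z d + t * dobjective P N z x0 + t ^+ 2 * 0 < 0.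
  apply: near0_quadratic_lt0; first exact: ltW.
  by move=> d0; move: dneg; rewrite d0 ltxx.
move=> nt.
near (0 : R)^'+ => t.
have t0 : 0 < t by near: t; exact: nbhs_right_gt.
have t1 : dobjective P N z d + t * dobjective P N z x0 + t ^+ 2 * 0 < 0 by near: t.
by move: t1; rewrite mulr0 addr0 ltNge ge0.
Unshelve. all: by end_near.
Qed.

(** Farkas' lemma is applied to the negated objective differential. Pinning the initial state counts
    as an extra family of equalities, whose multipliers disappear on directions with [d.1 1 = 0].
    Stationarity is stated for the differential, so that directions moving the initial state can
    still be evaluated afterwards. *)
Lemma kkt_dlagrangian : exists ups zeta s q,
  (forall d, d.1 1%N = 0 -> dlagrangian P N D ups zeta s q z u d = 0) /\
  [/\ forall i j, (1 <= i <= N.+1)%N -> zeta i j * Hobs P j (z i) = 0 /\ 0 <= zeta i j,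
      forall i, (1 <= i <= N.+1)%N -> s i * G1 P (z i) = 0 /\ 0 <= s i
    & forall i, (1 <= i <= N)%N -> q i * G2 P (u i) = 0 /\ 0 <= q i].
Proof.
pose e (k : 'I_nz + 'I_N * 'I_nz) d : R := match k with
  | inl c => d.1 1%N c 0 | inr kc => dresidual D kc.1.+1 d kc.2 0 end.
(* The indicator replaces an inactive constraint by the zero functional, keeping the index type
   independent of the active set. *)
pose a (k : 'I_N.+1 * 'I_nobs + 'I_N.+1 + 'I_N) d : R := match k with
  | inl (inl kj) => (Hobs P kj.2 (z kj.1.+1) == 0)%:R * dHobs P z kj.1.+1 kj.2 d
  | inl (inr k) => (G1 P (z k.+1) == 0)%:R * dG1 P z k.+1 d
  | inr k => (G2 P (u k.+1) == 0)%:R * dG2 P u k.+1 d end.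
have le k : scalar (e k).
  by case: k => [c|[k c]] h x y /=; rewrite ?dresidual_linear !mxE.
have la k : scalar (a k).
  case: k => [[[k j]|k]|k] /=; apply: (proj1 (expansionZ _ _)).
  - exact: (expansion_Hobs P k.+1 j z u).
  - exact: (expansion_G1 P k.+1 z u).
  - exact: (expansion_G2 P k.+1 z u).
have [lobj _] := expansion_objective N z u hQ0.
have lc : scalar (fun d => - dobjective P N z d).
  by move=> h x y; rewrite lobj; ring.
have [d de da|m [l [l0 lE]]] := farkas le la lc.
  rewrite oppr_le0; apply: objective_ge0.
  - by apply/matrixP => c b; rewrite ord1 [RHS]mxE; exact: (de (inl c)).
  - case=> // i /= iN; apply/matrixP => c b; rewrite ord1 [RHS]mxE.
    exact: (de (inr (Ordinal iN, c))).
  - case=> // i j /= iN Hij.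
    by have := da (inl (inl (Ordinal (iN : i < N.+1)%N, j))); rewrite /= Hij eqxx mul1r.
  - case=> // i /= iN Hij.
    by have := da (inl (inr (Ordinal (iN : i < N.+1)%N))); rewrite /= Hij eqxx mul1r.
  - case=> // i /= iN Hij.
    by have := da (inr (Ordinal iN)); rewrite /= Hij eqxx mul1r.
(* The multipliers absorb the activity indicators, which yields complementary slackness. *)
pose ups := extend_ord 0 (fun k : 'I_N => \col_c m (inr (k, c))).
pose zeta := extend_ord (fun=> 0) (fun (k : 'I_N.+1) j =>
  l (inl (inl (k, j))) * (Hobs P j (z k.+1) == 0)%:R).
pose s := extend_ord 0 (fun k : 'I_N.+1 => l (inl (inr k)) * (G1 P (z k.+1) == 0)%:R).
pose q := extend_ord 0 (fun k : 'I_N => l (inr k) * (G2 P (u k.+1) == 0)%:R).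
have slack x (t : R) : 0 <= t -> t * (x == 0 :> R)%:R * x = 0 /\ 0 <= t * (x == 0)%:R.
  by move=> t0; case: eqP => [->|_]; rewrite !(mulr0, mul0r, mulr1).
exists ups, zeta, s, q; split; last split.
- move=> d d1; have := lE d; rewrite !big_sumType /= big1 ?add0r; last first.
    by move=> c _; rewrite d1 mxE mulr0.
  move/eqP; rewrite eq_sym -subr_eq0 opprK => /eqP <-.
  rewrite /dlagrangian; move: (dobjective P N z d) => o.
  rewrite !big_add1 !big_mkord /= -!addrA addrC -!addrA.
  congr (_ + (_ + (_ + (_ + _)))).
  + rewrite (eq_bigr (fun p => m (inr (p.1, p.2)) * dresidual D p.1.+1 d p.2 0));
      last by case.
    rewrite -(pair_bigA _ (fun k c => m (inr (k, c)) * dresidual D k.+1 d c 0)) /=.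
    apply: eq_bigr => k _; rewrite mxE; apply: eq_bigr => c _.
    by rewrite mxE /ups extend_ordE mxE.
  + rewrite (eq_bigr (fun p => l (inl (inl (p.1, p.2))) *
      ((Hobs P p.2 (z p.1.+1) == 0)%:R * dHobs P z p.1.+1 p.2 d))); last by case.
    rewrite -(pair_bigA _ (fun k j => l (inl (inl (k, j))) *
      ((Hobs P j (z k.+1) == 0)%:R * dHobs P z k.+1 j d))) /=.
    apply: eq_bigr => k _; apply: eq_bigr => j _.
    by rewrite /zeta extend_ordE mulrA.
  + by apply: eq_bigr => k _; rewrite /s extend_ordE mulrA.
  + by apply: eq_bigr => k _; rewrite /q extend_ordE mulrA.
- case=> // i j /= iN; have := extend_ordE (fun=> 0) (fun (k : 'I_N.+1) j =>
    l (inl (inl (k, j))) * (Hobs P j (z k.+1) == 0)%:R) (Ordinal (iN : i < N.+1)%N).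
  by rewrite /= -/zeta => ->; exact: slack.
- case=> // i /= iN; have := extend_ordE 0 (fun k : 'I_N.+1 =>
    l (inl (inr k)) * (G1 P (z k.+1) == 0)%:R) (Ordinal (iN : i < N.+1)%N).
  by rewrite /= -/s => ->; exact: slack.
- case=> // i /= iN; have := extend_ordE 0 (fun k : 'I_N =>
    l (inr k) * (G2 P (u k.+1) == 0)%:R) (Ordinal iN).
  by rewrite /= -/q => ->; exact: slack.
Qed.

End KarushKuhnTucker.

(** * The adjoint recursion and the vanishing of the first multiplier *)

(** Gives the ordered products of [reachability] the monoid laws used to split off their last
    factor. *)
HB.instance Definition _ (R : realType) (n : nat) :=
  Monoid.isLaw.Build 'M[R]_n 1%:M mulmx (@mulmxA R n n n n) (@mul1mx R n n) (@mulmx1 R n n).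

Section AdjointRecursion.
Variables (R : realType) (nz nu : nat) (D : dynamics R nz nu).

Lemma mul_cV_eq0 k (x : 'rV[R]_k) : (forall v : 'cV_k, (x *m v) 0 0 = 0) -> x = 0.
Proof.
move=> x0; apply/matrixP => i j; rewrite ord1 [RHS]mxE.
by have := x0 (delta_mx j 0); rewrite -colE mxE.
Qed.

(** By the recursion, [(ups tau)^T] times block [k] of the reachability matrix is
    [(ups (tau - k))^T] times [dynB D (tau - k)], which is zero. Full row rank then gives
    [ups tau = 0], and the recursion carries this down to index 1. *)
Lemma adjoint_eq0 (tau : nat) (ups : nat -> 'cV[R]_nz) : (1 <= tau)%N ->
  \rank (reachability tau D tau) = nz ->
  (forall i, (1 <= i <= tau)%N -> (ups i)^T *m dynB D i = 0) ->
  (forall i, (1 < i <= tau)%N -> (ups i.-1)^T = (ups i)^T *m dynA D i) ->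
  ups 1%N = 0.
Proof.
move=> tau1 rk hB hA.
have prodE k : (k < tau)%N ->
    (ups tau)^T *m \big[mulmx/1%:M]_(0 <= l < k) dynA D (tau - l) = (ups (tau - k)%N)^T.
  elim: k => [_|k IHk kt]; first by rewrite big_nil mulmx1 subn0.
  rewrite big_nat_recr //= mulmxA IHk ?(ltnW kt) // subnS hA //.
  by rewrite ltn_subRL addn1 kt leq_subr.
have : (ups tau)^T *m reachability tau D tau = 0.
  rewrite /reachability mul_mxrow -[RHS]mxrow0; apply/eq_mxrow => k.
  by rewrite mulmxA prodE // hB // subn_gt0 ltn_ord leq_subr.
rewrite -[RHS](mul0mx _ (reachability tau D tau)).
move/(row_free_inj (introT eqP rk)) => ups0.
have := prodE tau.-1; rewrite ups0 mul0mx prednK // leqnn => /(_ isT).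
have -> : (tau - tau.-1 = 1)%N by lia.
by move=> /esym/(congr1 trmx); rewrite trmxK trmx0.
Qed.

End AdjointRecursion.

(** * The Lagrangian differential along directions supported at one stage *)

Section SingleDirections.
Variables (R : realType) (nz nu nobs : nat) (P : setting R nz nu nobs).
Variables (N : nat) (D : dynamics R nz nu).
Variables (ups : nat -> 'cV[R]_nz) (zeta : nat -> 'I_nobs -> R) (s q : nat -> R).
Implicit Types (z : nat -> 'cV[R]_nz) (u : nat -> 'cV[R]_nu).

Lemma dHobs0 z i j (d : traj R nz nu) : d.1 i = 0 -> dHobs P z i j d = 0.
Proof.
move=> di; rewrite /dHobs di.
have -> : pos2 P 0 = 0 by apply/matrixP => a b; rewrite !mxE.
by rewrite dquad0 oppr0.
Qed.

(** State [i] enters only residuals [i - 1] and [i], the former being absent for [i = 1]; the bound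
    [i <= N] keeps the final state, hence the objective, out. *)
Lemma dlagrangian_single_z z u i v : (1 <= i <= N)%N ->
  (forall j, zeta i j = 0) -> s i = 0 ->
  dlagrangian P N D ups zeta s q z u (single_z nu i v) =
  (if (1 < i)%N then ((ups i.-1)^T *m v) 0 0 else 0) - ((ups i)^T *m dynA D i *m v) 0 0.
Proof.
move=> iN zeta0 s0; rewrite /dlagrangian.
have -> : dobjective P N z (single_z nu i v) = 0.
  rewrite /dobjective /=; case: eqP => [iE|_]; last exact: dquad0.
  by move: iN; rewrite -iE ltnn andbF.
rewrite add0r [X in _ + X]big1 => [|k _]; last by rewrite /dG2 dquad0 mulr0.
rewrite [X in _ + X + 0]big1 => [|k _]; last first.
  rewrite /dG1 /=; case: eqP => [->|_]; last by rewrite dquad0 mulr0.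
  by rewrite s0 mul0r.
rewrite [X in _ + X + 0 + 0]big1 => [|k _]; last first.
  apply: big1 => j _; have [->|ki] := eqVneq k i; first by rewrite zeta0 mul0r.
  by rewrite dHobs0 ?mulr0 //= (negPf ki).
rewrite !addr0.
have -> : \sum_(1 <= k < N.+1) ((ups k)^T *m dresidual D k (single_z nu i v)) 0 0 =
    \sum_(1 <= k < N.+1) (if k == i.-1 then ((ups k)^T *m v) 0 0 else 0) -
    \sum_(1 <= k < N.+1) (if k == i then ((ups k)^T *m dynA D k *m v) 0 0 else 0).
  rewrite -sumrB; apply: eq_bigr => k _.
  rewrite /dresidual /= mulmx0 subr0 mulmxBr mxE [X in _ + X]mxE.
  have -> : (k == i.-1) = (k.+1 == i) by lia.
  by congr (_ - _); case: eqP => _; rewrite ?mulmxA // mulmx0 mxE.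
rewrite -!big_mkcond !big_nat1_eq ltnS iN; congr (_ - _).
by congr (if _ then _ else _); lia.
Qed.

Lemma dlagrangian_single_u z u i v : (1 <= i <= N)%N -> q i = 0 ->
  dlagrangian P N D ups zeta s q z u (single_u nz i v) =
  - ((ups i)^T *m dynB D i *m v) 0 0.
Proof.
move=> iN q0; rewrite /dlagrangian /dobjective dquad0 add0r.
rewrite [X in _ + X]big1 => [|k _]; last first.
  rewrite /dG2 /=; case: eqP => [->|_]; last by rewrite dquad0 mulr0.
  by rewrite q0 mul0r.
rewrite [X in _ + X + 0]big1 => [|k _]; last by rewrite /dG1 dquad0 mulr0.
rewrite [X in _ + X + 0 + 0]big1 => [|k _]; last first.
  by apply: big1 => j _; rewrite dHobs0 ?mulr0.
rewrite !addr0.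
have -> : \sum_(1 <= k < N.+1) ((ups k)^T *m dresidual D k (single_u nz i v)) 0 0 =
    - \sum_(1 <= k < N.+1) (if k == i then ((ups k)^T *m dynB D k *m v) 0 0 else 0).
  rewrite -sumrN; apply: eq_bigr => k _.
  rewrite /dresidual /= mulmx0 subr0 sub0r mulmxN mxE.
  by congr (- _); case: eqP => _; rewrite ?mulmxA // mulmx0 mxE.
by rewrite -big_mkcond big_nat1_eq ltnS iN.
Qed.

(** Entry 0 is excluded because a shifted concatenation and the second sequence may differ there. *)
Lemma dlagrangian_ext z u z' u' d :
  (forall i, (1 <= i)%N -> z i = z' i) -> (forall i, (1 <= i)%N -> u i = u' i) ->
  dlagrangian P N D ups zeta s q z u d = dlagrangian P N D ups zeta s q z' u' d.
Proof.
move=> zz uu; rewrite /dlagrangian.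
congr (_ + _ + _ + _ + _); first by rewrite /dobjective zz.
- apply: eq_big_nat => i /andP[i1 _]; apply: eq_bigr => j _.
  by rewrite /dHobs zz.
- by apply: eq_big_nat => i /andP[i1 _]; rewrite /dG1 zz.
- by apply: eq_big_nat => i /andP[i1 _]; rewrite /dG2 uu.
Qed.

(** Input directions and state directions beyond stage 1 are admissible in [dL0] and yield the
    adjoint relations; the derivative in the pinned state then reduces to [ups 1], which is zero. *)
Lemma dlagrangian_initial_state tau z u v : (1 <= tau <= N)%N ->
  \rank (reachability tau D tau) = nz ->
  (forall d, d.1 1%N = 0 -> dlagrangian P N D ups zeta s q z u d = 0) ->
  (forall i j, (1 <= i <= tau)%N -> zeta i j = 0) ->
  (forall i, (1 <= i <= tau)%N -> s i = 0) ->
  (forall i, (1 <= i <= tau)%N -> q i = 0) ->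
  dlagrangian P N D ups zeta s q z u (single_z nu 1 v) = 0.
Proof.
move=> /andP[tau1 tauN] rk dL0 zeta0 s0 q0.
have ups1 : ups 1%N = 0.
  apply: (adjoint_eq0 tau1 rk) => i /andP[i1 it].
    apply: mul_cV_eq0 => w; apply/eqP; rewrite -oppr_eq0.
    rewrite -(@dlagrangian_single_u z u) ?dL0 ?q0 ?i1 //.
    exact: leq_trans it tauN.
  apply/eqP; rewrite -subr_eq0; apply/eqP/mul_cV_eq0 => w.
  have it' : (1 <= i <= tau)%N by rewrite it ltnW.
  have iN : (1 <= i <= N)%N by rewrite (ltnW i1) (leq_trans it tauN).
  have := dlagrangian_single_z z u w iN (fun j => zeta0 i j it') (s0 i it').
  have -> : ((ups i.-1)^T - (ups i)^T *m dynA D i) *m w =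
      (ups i.-1)^T *m w - (ups i)^T *m dynA D i *m w by rewrite mulmxBl.
  have entryB (X Y : 'M[R]_1) : (X - Y) 0 0 = X 0 0 - Y 0 0 by rewrite !mxE.
  rewrite i1 entryB => <-.
  (* Since [1 < i], this direction does not move the initial state. *)
  by rewrite dL0 //= ltn_eqF.
have t1 : (1 <= 1 <= tau)%N by rewrite tau1.
have N1 : (1 <= 1 <= N)%N by rewrite (leq_trans tau1 tauN).
rewrite (dlagrangian_single_z z u v N1 (fun j => zeta0 _ j t1) (s0 _ t1)).
by rewrite ltnn ups1 trmx0 !mul0mx mxE subrr.
Qed.

End SingleDirections.

(** * Shifting the second problem inside the concatenated one *)

Section Concatenation.
Variables (R : realType) (nz nu nobs : nat) (P : setting R nz nu nobs).
Variables (m' n : nat) (D1 D2 : dynamics R nz nu).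

(** Stage [k] of the second problem is stage [m' + k] of the concatenated one; index [m'] gets the
    default rather than the junk entry 0. *)
Definition shift_right (T : Type) (x0 : T) (f : nat -> T) (i : nat) : T :=
  if (i <= m')%N then x0 else f (i - m')%N.

Definition shift_left (T : Type) (f : nat -> T) (k : nat) : T := f (m' + k)%N.

Lemma sum_shift (F G : nat -> R) N :
  (forall i, (i <= m')%N -> F i = 0) ->
  (forall k, (1 <= k)%N -> F (m' + k)%N = G k) ->
  \sum_(1 <= i < (m' + N).+1) F i = \sum_(1 <= k < N.+1) G k.
Proof.
move=> F0 FG; elim: N => [|N IHN].
  rewrite addn0 [RHS]big_geq // big_nat_cond big1 // => i.
  by rewrite andbT ltnS => /andP[_ /F0].
by rewrite addnS big_nat_recr //= [RHS]big_nat_recr //= IHN -addnS FG.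
Qed.

Lemma shift_rightE (T : Type) (x0 : T) f k : (1 <= k)%N ->
  shift_right x0 f (m' + k) = f k.
Proof.
by move=> k1; rewrite /shift_right -[X in (_ <= X)%N]addn0 leq_add2l leqNgt k1 addKn.
Qed.

(** The identity holds for arbitrary [z] and [u], so it may be differentiated in every variable,
    including the junction state [m' + 1], which the right side reads as its state 1. *)
Lemma lagrangian_concat ups zeta s q z u :
  lagrangian P (m' + n) (concat_dynamics m' D1 D2) (shift_right 0 ups)
    (shift_right (fun=> 0) zeta) (shift_right 0 s) (shift_right 0 q) z u =
  lagrangian P n D2 ups zeta s q (shift_left z) (shift_left u).
Proof.
have sr0 (T : Type) (x0 : T) f i : (i <= m')%N -> shift_right x0 f i = x0.
  by rewrite /shift_right => ->.
rewrite /lagrangian /objective /shift_left; congr (_ + _ + _ + _ + _).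
- by rewrite addnS.
- apply: sum_shift => [i im|k k1]; first by rewrite sr0 // trmx0 mul0mx mxE.
  rewrite shift_rightE // /residual /=.
  by rewrite -[X in (_ <= X)%N]addn0 leq_add2l leqNgt k1 /= addKn addnS.
- rewrite -addnS; apply: sum_shift => [i im|k k1].
    by rewrite big1 // => j _; rewrite sr0 // mul0r.
  by apply: eq_bigr => j _; rewrite shift_rightE.
- by rewrite -addnS; apply: sum_shift => [i im|k k1];
    [rewrite sr0 // mul0r | rewrite shift_rightE].
- by apply: sum_shift => [i im|k k1];
    [rewrite sr0 // mul0r | rewrite shift_rightE].
Qed.

Lemma expansion_lagrangian_concat ups zeta s q z u : posdefmx (Q0 P) ->
  expansion (lagrangian P (m' + n) (concat_dynamics m' D1 D2) (shift_right 0 ups)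
    (shift_right (fun=> 0) zeta) (shift_right 0 s) (shift_right 0 q)) z u
  (fun d => dlagrangian P n D2 ups zeta s q (shift_left z) (shift_left u)
    (shift_left d.1, shift_left d.2)).
Proof.
move=> hQ0.
have [lL [c cE]] :=
  expansion_lagrangian n D2 ups zeta s q (shift_left z) (shift_left u) hQ0.
split=> [k x y|]; first exact: (lL k (_, _) (_, _)).
exists (fun d => c (shift_left d.1, shift_left d.2)) => h d.
rewrite !lagrangian_concat; exact: (cE h (_, _)).
Qed.

(** At [k = 1] the entry is still taken from [z1], so this case rests on the pinning of the second
    problem. *)
Lemma concat_statesE (z1 z2 : nat -> 'cV[R]_nz) k : z2 1%N = z1 m'.+1 -> (1 <= k)%N ->
  concat_states m' z1 z2 (m' + k) = z2 k.
Proof.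
rewrite /concat_states => z21; case: k => [|[|k]] // _; rewrite addnS ltnS.
  by rewrite addn0 leqnn z21.
by rewrite addnS ltnNge leq_addr /= -!addnS addKn.
Qed.

Lemma concat_inputsE (u1 u2 : nat -> 'cV[R]_nu) k : (1 <= k)%N ->
  concat_inputs m' u1 u2 (m' + k) = u2 k.
(* By conversion, with [u1 (m' + k)] as the default value. *)
Proof. exact: (@shift_rightE _ _ u2 k). Qed.

End Concatenation.

(** * Feasibility and stationarity of the concatenated sequence *)

Theorem corollary1 (R : realType) (nz nu nobs : nat) (P : setting R nz nu nobs)
  (hQ0 : posdefmx (Q0 P)) (hQ1 : posdefmx (Q1 P)) (hQ2 : posdefmx (Q2 P))
  (hr : forall j, 0 < radius P j)
  (tau m n m' : nat)
  (htau : (1 <= tau)%N)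
  (hm' : (1 <= m' <= m - 1)%N)
  (hm'tau : (m' + tau - 1 <= m)%N)
  (htaun : (tau <= n)%N)
  (y0 : 'cV[R]_nz * 'cV[R]_nu)
  (D1 D2 : dynamics R nz nu)
  (z1 z2 : nat -> 'cV[R]_nz) (u1 u2 : nat -> 'cV[R]_nu)
  (hopt1 : local_optimizer P y0 m D1 z1 u1)
  (hopt2 : local_optimizer P (z1 m'.+1, u1 m') n D2 z2 u2)
  (hrank1 : rank_condition tau m D1)
  (hrank2 : rank_condition tau n D2)
  (hMFCQ1 : MFCQ P m D1 z1 u1)
  (hMFCQ2 : MFCQ P n D2 z2 u2)
  (hu1 : forall i, (m' <= i <= m' + tau - 1)%N -> quad (Q2 P) (u1 i) < 1)
  (hu2 : forall i, (1 <= i <= tau)%N -> quad (Q2 P) (u2 i) < 1)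
  (hz1 : forall i, (m' + 1 <= i <= m' + tau - 1)%N ->
     (forall j, radius P j < obs_dist P (z1 i) j) /\ quad (Q1 P) (z1 i) < 1)
  (hz2 : forall i, (1 <= i <= tau)%N ->
     (forall j, radius P j < obs_dist P (z2 i) j) /\ quad (Q1 P) (z2 i) < 1) :
  KKT P y0 (m' + n) (concat_dynamics m' D1 D2)
    (concat_states m' z1 z2) (concat_inputs m' u1 u2).
Proof.
have [[f11 f12 f13 f14 f15] _] := hopt1.
have [[f21 f22 f23 f24 f25] _] := hopt2.
have [ups [zeta [s [q [dL0 [zetaP sP qP]]]]]] := kkt_dlagrangian hQ0 hr hopt2 hMFCQ2.
have taun1 : (1 <= tau <= n)%N by rewrite htau.
have in_n i : (1 <= i <= tau)%N -> (1 <= i <= n)%N.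
  by move=> /andP[-> it]; exact: leq_trans it htaun.
have in_n1 i : (1 <= i <= tau)%N -> (1 <= i <= n.+1)%N.
  by move=> /in_n/andP[-> it]; exact: leqW.
(* Strict feasibility on the first [tau] stages removes the inequality multipliers there. *)
have slack0 (t x : R) : x < 0 -> t * x = 0 -> t = 0.
  by move=> x0 /eqP; rewrite mulf_eq0 (lt_eqF x0) orbF => /eqP.
have zeta0 i j : (1 <= i <= tau)%N -> zeta i j = 0.
  move=> it; have [h _] := zetaP i j (in_n1 i it); apply: slack0 h.
  by rewrite -obs_lt_Hobs //; have [] := hz2 i it.
have s0 i : (1 <= i <= tau)%N -> s i = 0.
  move=> it; have [h _] := sP i (in_n1 i it); apply: slack0 h.
  by rewrite subr_lt0; have [] := hz2 i it.
have q0 i : (1 <= i <= tau)%N -> q i = 0.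
  move=> it; have [h _] := qP i (in_n i it); apply: slack0 h.
  by rewrite subr_lt0; exact: hu2.
have rk : \rank (reachability tau D2 tau) = nz.
  by apply: (proj2 hrank2); rewrite leqnn.
have dL1 v : dlagrangian P n D2 ups zeta s q z2 u2 (single_z nu 1 v) = 0.
  exact: (dlagrangian_initial_state v taun1 rk dL0 zeta0 s0 q0).
have zcE k : (1 <= k)%N -> concat_states m' z1 z2 (m' + k) = z2 k.
  exact: concat_statesE.
have ucE k : (1 <= k)%N -> concat_inputs m' u1 u2 (m' + k) = u2 k.
  exact: concat_inputsE.
have dext := @dlagrangian_ext _ _ _ _ P n D2 ups zeta s q _ _ z2 u2 _ zcE ucE.
have eL := @expansion_lagrangian_concat _ _ _ _ P m' n D1 D2 ups zeta s q
  (concat_states m' z1 z2) (concat_inputs m' u1 u2) hQ0.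
have split_index i : (i <= m')%N \/ exists2 k, (1 <= k)%N & i = (m' + k)%N.
  have [im|im] := leqP i m'; [by left | right].
  by exists (i - m')%N; [rewrite subn_gt0 | rewrite subnKC // ltnW].
have zc_low i : (i <= m'.+1)%N -> concat_states m' z1 z2 i = z1 i.
  by rewrite /concat_states => ->.
have uc_low i : (i <= m')%N -> concat_inputs m' u1 u2 i = u1 i.
  by rewrite /concat_inputs => ->.
have [m'1 m'm] : (1 <= m')%N /\ (m' < m)%N by lia.
split.
  split.
  - by rewrite zc_low.
  (* For [i = m'] the successor is the junction state, which [zc_low] still reads from [z1]; for
     [k = 1] the same state is read as [z2 1]. *)
  - move=> i iN; have [im|[k k1 iE]] := split_index i.
      rewrite zc_low // zc_low ?leqW // uc_low //= im; apply: f12; lia.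
    rewrite iE -addnS !zcE // ucE //= -[X in (_ <= X)%N]addn0 leq_add2l leqNgt k1 /=.
    by rewrite addKn; apply: f22; lia.
  - move=> i iN; have [im|[k k1 iE]] := split_index i.
      by rewrite zc_low ?leqW //; apply: f13; lia.
    by rewrite iE zcE //; apply: f23; lia.
  - move=> i iN; have [im|[k k1 iE]] := split_index i.
      by rewrite uc_low //; apply: f14; lia.
    by rewrite iE ucE //; apply: f24; lia.
  - move=> i j iN; have [im|[k k1 iE]] := split_index i.
      by rewrite zc_low ?leqW //; apply: f15; lia.
    by rewrite iE zcE //; apply: f25; lia.
exists (shift_right m' 0 ups), (shift_right m' (fun=> 0) zeta),
  (shift_right m' 0 s), (shift_right m' 0 q); split.
- move=> i iN; rewrite (expansion_partial_z _ eL); apply/matrixP => a b.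
  (* At the junction the shifted direction moves the initial state of the second problem, handled by
     [dL1]; for every other [i] it fixes that state, so [dL0] applies. *)
  rewrite !mxE dext; have [->|im] := eqVneq i m'.+1.
    rewrite -[RHS](dL1 (delta_mx a 0)); congr (dlagrangian _ _ _ _ _ _ _ _ _ (_, _)).
    by apply/funext => k; rewrite /shift_left /= -[m'.+1]addn1 eqn_add2l.
  by apply: dL0; rewrite /shift_left /= addn1 eq_sym (negPf im).
- move=> i iN; rewrite (expansion_partial_u _ eL); apply/matrixP => a b.
  by rewrite !mxE dext; apply: dL0.
- move=> i j iN; have [im|[k k1 iE]] := split_index i.
    by rewrite /shift_right im mul0r.
  by rewrite iE shift_rightE // zcE //; apply: zetaP; lia.
- move=> i iN; have [im|[k k1 iE]] := split_index i.
    by rewrite /shift_right im mul0r.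
  by rewrite iE shift_rightE // zcE //; apply: sP; lia.
- move=> i iN; have [im|[k k1 iE]] := split_index i.
    by rewrite /shift_right im mul0r.
  by rewrite iE shift_rightE // ucE //; apply: qP; lia.
Qed.
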